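(* $t(K(7,3))=\frac{4}{3}$. Moreover, if $S$ is a vertex cut of $K(7,3)$ such that $\frac{|S|}{c(K(7,3)\setminus S)} = \frac{4}{3}$, then $S$ is the complement of a maximum independent set of $K(7,3)$.
   Context: The Kneser graph $K(n,k)$ has as vertices the $k$-element subsets of $[n]=\{1,\dots,n\}$, two vertices being adjacent iff they are disjoint. A vertex cut is a set $S$ of vertices whose removal disconnects the graph; $c(G\setminus S)$ is the number of connected components after deleting $S$; the toughness is $t(G)=\min_S |S|/c(G\setminus S)$ over vertex cuts $S$. *)

(* Defs.v *)
From mathcomp Require Import all_boot all_order all_algebra.
Set Implicit Arguments. Unset Strict Implicit. Unset Printing Implicit Defensive.
Import Order.TTheory GRing.Theory Num.Theory.

Section Graph.
Variables (V : finType) (adj : rel V).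

Definition adj_minus (S : {set V}) : rel V :=
  fun u v => [&& u \notin S, v \notin S & adj u v].

Definition comp_minus (S : {set V}) (x : V) : {set V} :=
  [set y in ~: S | connect (adj_minus S) x y].

Definition ncomp_minus (S : {set V}) : nat :=
  #|[set comp_minus S x | x in ~: S]|.

Definition vertex_cut (S : {set V}) : bool := 1 < ncomp_minus S.

Definition cut_ratio (S : {set V}) : rat :=
  (#|S|%:R / (ncomp_minus S)%:R)%R.

(* toughness: minimum of |S| / c(G\S) over all vertex cuts S.
   (The default value #|V| is only used if there is no vertex cut,
    i.e. for complete graphs; it is irrelevant otherwise since every
    cut ratio is < #|V|.) *)
Definition toughness : rat :=
  \big[Num.min/(#|V|%:R)%R]_(S : {set V} | vertex_cut S) cut_ratio S.

Definition independent (A : {set V}) : bool :=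
  [forall u in A, forall v in A, ~~ adj u v].

Definition max_independent (A : {set V}) : bool :=
  independent A && [forall B : {set V}, independent B ==> (#|B| <= #|A|)].

End Graph.

Definition kneser_vertex (n k : nat) := {A : {set 'I_n} | #|A| == k}.

Definition kneser_adj (n k : nat) : rel (kneser_vertex n k) :=
  fun u v => [disjoint val u & val v].
Arguments kneser_adj : clear implicits.

(* Main.v *)
(** K(7,3) is 4-regular and its adjacency matrix satisfies
    A^3 + 2A^2 - 5A - 6I = 2J, so x^T A x >= (sum x)^2 / 5 - 3|x|^2 and
    x^T A x <= 2|x|^2 + 2(sum x)^2 / 35 for every vector x.  For a component C
    of the graph minus S let m = |C| and let k be twice the number of edges
    in C.  The first inequality, applied to the vector equal to m/(3m+k) on
    each component C and to 0 on S, gives sum_C m^2/(3m+k) <= 5.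
    The second inequality for 4 <= m <= 30, and triangle-freeness for m <= 3,
    give m + 4/3 <= 7m^2/(3m+k), strictly unless m = 1; a component has at most
    30 vertices since it misses the closed neighbourhood of a vertex of another
    component.  Summing, (35 - |S|) + (4/3) c <= 35, with equality
    only if all components are single vertices. *)
Require Import Defs.
From mathcomp Require Import all_boot all_order all_algebra.
From mathcomp Require Import zify ring lra.
Set Implicit Arguments. Unset Strict Implicit. Unset Printing Implicit Defensive.
Import Order.TTheory GRing.Theory Num.Theory.
Local Open Scope ring_scope.

(** * Quadratic forms of a regular graph satisfying a cubic matrix relation *)

Section QuadraticForms.
Variables (V : finType) (a : V -> V -> rat).
Hypothesis a_sym : forall u v, a u v = a v u.
Hypothesis a_regular : forall u, \sum_v a u v = 4%:R.
Hypothesis cardV : #|V| = 35%N.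
Hypothesis a_cubic : forall u v,
  \sum_w a u w * (\sum_z a w z * a z v) + 2%:R * (\sum_w a u w * a w v)
  = 5%:R * a u v + 6%:R * (u == v)%:R + 2%:R.

Definition adj_op (x : V -> rat) (u : V) : rat := \sum_v a u v * x v.
Definition dot (x y : V -> rat) : rat := \sum_u x u * y u.

Lemma dotC x y : dot x y = dot y x.
Proof. by apply: eq_bigr => u _; rewrite mulrC. Qed.

Lemma dot_adj_op x y : dot x (adj_op y) = dot (adj_op x) y.
Proof.
rewrite /dot /adj_op.
under eq_bigr do rewrite mulr_sumr.
rewrite exchange_big /=; apply: eq_bigr => v _; rewrite mulr_suml.
by apply: eq_bigr => u _; rewrite (a_sym v u); ring.
Qed.

Lemma sum_adj_op x : \sum_u adj_op x u = 4%:R * \sum_u x u.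
Proof.
rewrite /adj_op exchange_big /= mulr_sumr; apply: eq_bigr => v _.
by rewrite -mulr_suml; under eq_bigr do rewrite a_sym; rewrite a_regular.
Qed.

Lemma adj_op_cube x u :
  adj_op (adj_op (adj_op x)) u =
  - 2%:R * adj_op (adj_op x) u + 5%:R * adj_op x u + 6%:R * x u
  + 2%:R * \sum_v x v.
Proof.
have op2 y w : adj_op (adj_op y) w = \sum_v (\sum_z a w z * a z v) * y v.
  rewrite /adj_op; under eq_bigr do rewrite mulr_sumr.
  rewrite exchange_big /=; apply: eq_bigr => v _; rewrite mulr_suml.
  by apply: eq_bigr => z _; rewrite mulrA.
have op3 : adj_op (adj_op (adj_op x)) u =
    \sum_v (\sum_w a u w * (\sum_z a w z * a z v)) * x v.
  rewrite {1}/adj_op; under eq_bigr do rewrite op2 mulr_sumr.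
  rewrite exchange_big /=; apply: eq_bigr => v _; rewrite mulr_suml.
  by apply: eq_bigr => z _; rewrite mulrA.
have delta : x u = \sum_v (u == v)%:R * x v.
  rewrite (bigD1 u) //= eqxx mul1r big1 ?addr0 // => v.
  by rewrite eq_sym => /negbTE ->; rewrite mul0r.
rewrite op3 op2 /adj_op {1}delta !mulr_sumr -!big_split /=.
apply: eq_bigr => v _.
have -> : \sum_w a u w * (\sum_z a w z * a z v) =
   5%:R * a u v + 6%:R * (u == v)%:R + 2%:R - 2%:R * (\sum_w a u w * a w v).
  by rewrite -a_cubic; ring.
ring.
Qed.

(** This is the sum over [u] of the squares of [al * z u + be * y u + ga * x u + de], expanded;
    4-regularity makes the entries of [y] and [z] sum to [4 s] and [16 s]. Choosing [de]
    proportional to [s] produces the J terms. *)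
Lemma quadratic_expansion x y z (s al be ga de : rat) :
  y = adj_op x -> z = adj_op y -> s = \sum_u x u ->
  0 <= al ^+ 2 * dot z z + be ^+ 2 * dot y y + ga ^+ 2 * dot x x
    + 35%:R * de ^+ 2 + 2%:R * al * be * dot y z + 2%:R * al * ga * dot x z
    + 2%:R * be * ga * dot x y
    + 2%:R * de * (16%:R * al + 4%:R * be + ga) * s.
Proof.
move=> yE zE sE.
have sy : \sum_u y u = 4%:R * s by rewrite yE sE sum_adj_op.
have sz : \sum_u z u = 16%:R * s by rewrite zE sum_adj_op sy; ring.
have s1 : \sum_(u : V) (1 : rat) = 35%:R by rewrite sumr_const cardV.
have -> : al ^+ 2 * dot z z + be ^+ 2 * dot y y + ga ^+ 2 * dot x x
    + 35%:R * de ^+ 2 + 2%:R * al * be * dot y z + 2%:R * al * ga * dot x z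
    + 2%:R * be * ga * dot x y + 2%:R * de * (16%:R * al + 4%:R * be + ga) * s
  = \sum_u (al * z u + be * y u + ga * x u + de) ^+ 2.
  transitivity (al ^+ 2 * dot z z + be ^+ 2 * dot y y + ga ^+ 2 * dot x x
    + de ^+ 2 * (\sum_(u : V) 1)
    + 2%:R * al * be * dot y z + 2%:R * al * ga * dot x z
    + 2%:R * be * ga * dot x y + 2%:R * de * al * (\sum_u z u)
    + 2%:R * de * be * (\sum_u y u) + 2%:R * de * ga * (\sum_u x u)).
    by rewrite sy sz s1 -sE; ring.
  rewrite /dot !mulr_sumr -!big_split /=.
  by apply: eq_bigr => u _; ring.
by apply: sumr_ge0 => u _; apply: sqr_ge0.
Qed.

Lemma dot_cube x y : dot y (adj_op (adj_op (adj_op x))) =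
  - 2%:R * dot y (adj_op (adj_op x)) + 5%:R * dot y (adj_op x)
  + 6%:R * dot y x + 2%:R * (\sum_u x u) * (\sum_u y u).
Proof.
rewrite /dot; under eq_bigr do rewrite adj_op_cube.
move: (\sum_u x u) => s; rewrite !mulr_sumr -!big_split /=.
by apply: eq_bigr => u _; ring.
Qed.

(** The cubic relation reads (A + 1)(A + 3)(A - 2) = 2J, so away from the constants A has
    eigenvalues among 2, -1 and -3. Hence 5A + 15 - J and 70 + 2J - 35A are positive
    semidefinite. *)
Lemma quadratic_forms x :
  (\sum_u x u) ^+ 2 <= 5%:R * dot x (adj_op x) + 15%:R * dot x x /\
  35%:R * dot x (adj_op x) <= 70%:R * dot x x + 2%:R * (\sum_u x u) ^+ 2.
Proof.
set s := \sum_u x u.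
have p2 : dot x (adj_op (adj_op x)) = dot (adj_op x) (adj_op x).
  exact: dot_adj_op.
have p3 := dot_cube x x; have p4 := dot_cube x (adj_op x).
rewrite sum_adj_op in p4; rewrite dot_adj_op in p3.
(* The fourth-order term is rewritten so that a third power appears and the cubic relation can
   reduce it. *)
have e4 : dot (adj_op (adj_op x)) (adj_op (adj_op x)) =
          dot (adj_op x) (adj_op (adj_op (adj_op x))).
  by rewrite [RHS]dot_adj_op.
rewrite -/s in p3 p4; rewrite (dotC (adj_op x) x) in p4.
(* The three squares: [A^2 + A - 6 - (2/5)J], [A + 3 - J/5], [2 + (2/35)J - A]
   applied to x. *)
have qE := @quadratic_expansion x _ _ s 1 1 (- 6%:R) (- (2%:R / 5%:R) * s)
  erefl erefl erefl.
have qM := @quadratic_expansion x _ _ s 0 1 3%:R (- s / 5%:R)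
  erefl erefl erefl.
have qN := @quadratic_expansion x _ _ s 0 (- 1) 2%:R (2%:R / 35%:R * s)
  erefl erefl erefl.
move: qE qM qN; rewrite e4 p4 p3 p2.
set P0 := dot x x; set P1 := dot x _; set P2 := dot _ _ => qE qM qN.
(* With E, M, N the three operators squared above, 5A + 15 - J = M^2 + E^2/6 and 70 + 2J - 35A = 7
   N^2 + (7/6) E^2. *)
split; nra.
Qed.
End QuadraticForms.

(** * Walks of length two and three in K(7,3) *)

Local Notation vertex := (kneser_vertex 7 3).
Local Notation adj := (kneser_adj 7 3).

Lemma card_vertex (u : vertex) : #|val u| = 3%N.
Proof. exact/eqP/(valP u). Qed.

Lemma card_kneser : #|{: vertex}| = 35%N.
Proof.
have -> : 35%N = 'C(#|'I_7|, 3) by rewrite card_ord.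
by rewrite card_sig -card_draws cardsE.
Qed.

Lemma kneser_sym : symmetric adj.
Proof. by move=> u v; rewrite /kneser_adj disjoint_sym. Qed.

Lemma kneser_irr : irreflexive adj.
Proof.
move=> u; apply/negbTE; rewrite /kneser_adj -setI_eq0 setIid.
by rewrite -cards_eq0 card_vertex.
Qed.

Lemma card_neighbors_setC (B : {set 'I_7}) :
  #|[set w : vertex | val w \subset B]| = 'C(#|B|, 3).
Proof.
rewrite -cards_draws -(card_imset _ val_inj); apply: eq_card => A.
rewrite inE; apply/imsetP/andP => [[w]|[AB cA]].
  by rewrite inE => wB ->; rewrite wB (valP w).
by exists (Sub A cA); rewrite ?inE.
Qed.

(** Common neighbours are the triples avoiding [val u :|: val v]; if the intersection has i points,
    the union has 6 - i and its complement i + 1. *)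
Lemma card_common_neighbors (u v : vertex) :
  #|[set w | adj u w && adj w v]| = 'C(#|val u :&: val v|.+1, 3).
Proof.
transitivity 'C(#|~: (val u :|: val v)|, 3).
  rewrite -card_neighbors_setC; apply: eq_card => w; rewrite !inE /kneser_adj.
  by rewrite setCU subsetI !subsets_disjoint !setCK disjoint_sym.
congr 'C(_, 3).
have := cardsC (val u :|: val v); have := cardsUI (val u) (val v).
by rewrite !card_vertex card_ord; lia.
Qed.

Lemma card_neighbors (u : vertex) : #|[set w | adj u w]| = 4%N.
Proof.
transitivity 'C(#|val u :&: val u|.+1, 3); last by rewrite setIid card_vertex.
rewrite -card_common_neighbors; apply: eq_card => w; rewrite !inE.
by rewrite (kneser_sym w) andbb.
Qed.

(** The four points [d] outside [u] give four distinct neighbours, and [u] has only four; so a sum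
    over neighbours becomes a sum over points. *)
Lemma sum_neighbors (u : vertex) (f : {set 'I_7} -> nat) :
  \sum_(w | adj u w) f (val w) = \sum_(d in ~: val u) f (~: val u :\ d).
Proof.
have cD : #|~: val u| = 4%N.
  by have := cardsC (val u); rewrite card_vertex card_ord; lia.
pose h d : vertex := insubd u (~: val u :\ d).
have hE d : d \in ~: val u -> val (h d) = ~: val u :\ d.
  move=> dD; rewrite val_insubd.
  by have := cardsD1 d (~: val u); rewrite dD cD add1n => -[<-].
have h_inj : {in ~: val u &, injective h}.
  move=> d e dD eD /(congr1 val); rewrite !hE // => /setP /(_ d).
  by rewrite 2!inE eqxx andFb in_setD1 dD andbT => /esym/negbT/negPn/eqP.
have -> : \sum_(w | adj u w) f (val w) = \sum_(w in h @: (~: val u)) f (val w).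
  apply: eq_bigl => w; rewrite -[LHS]in_set.
  suff <- : h @: (~: val u) = [set w | adj u w] by [].
  apply/eqP; rewrite eqEcard card_neighbors card_in_imset // cD leqnn andbT.
  apply/subsetP => _ /imsetP[d dD ->]; rewrite inE /kneser_adj hE //.
  by rewrite disjoint_sym disjoints_subset subD1set.
by rewrite big_imset //; apply: eq_bigr => d dD; rewrite hE.
Qed.

(* The neighbours of u are the sets [~: u :\ d], and such a set meets v in q - 1
   points if d lies in v, in q points otherwise. *)
Lemma card_walks3 (u v : vertex) (q := #|~: val u :&: val v|) :
  \sum_(w | adj u w) 'C(#|val w :&: val v|.+1, 3) =
  (q * 'C(q, 3) + (4 - q) * 'C(q.+1, 3))%N.
Proof.
have cD : #|~: val u| = 4%N.
  by have := cardsC (val u); rewrite card_vertex card_ord; lia.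
rewrite (sum_neighbors u (fun A => 'C(#|A :&: val v|.+1, 3))).
rewrite (big_setID (val v)); congr (_ + _)%N.
  rewrite -sum_nat_const; apply: eq_bigr => d dI; congr 'C(_, 3).
  by rewrite setIDAC /q [in RHS](cardsD1 d) dI.
have -> : (4 - q)%N = #|~: val u :\: val v| by rewrite cardsD cD.
rewrite -sum_nat_const; apply: eq_bigr => d; rewrite !inE => /andP[dv _].
congr 'C(_.+1, 3); apply: eq_card => e; rewrite !inE.
by case: eqP => //= ->; rewrite (negbTE dv) andbF.
Qed.

Definition kneser_entry (u v : vertex) : rat := (adj u v)%:R.

Lemma kneser_entry_sym u v : kneser_entry u v = kneser_entry v u.
Proof. by rewrite /kneser_entry kneser_sym. Qed.

Lemma kneser_entry_regular u : \sum_v kneser_entry u v = 4%:R.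
Proof.
transitivity (#|[set v | adj u v]|%:R : rat); last by rewrite card_neighbors.
rewrite -sum1_card [in RHS]big_mkcond natr_sum.
by apply: eq_bigr => v _; rewrite /kneser_entry inE; case: adj.
Qed.

Lemma kneser_entry_square u v :
  \sum_w kneser_entry u w * kneser_entry w v = 'C(#|val u :&: val v|.+1, 3)%:R.
Proof.
rewrite -card_common_neighbors -sum1_card [in RHS]big_mkcond natr_sum.
apply: eq_bigr => w _; rewrite /kneser_entry -natrM mulnb inE.
by case: andP.
Qed.

(** Every entry involved depends only on [#|val u :&: val v|], which leaves four numerical checks,
    for intersections of size 0 to 3. *)
Lemma kneser_entry_cubic u v :
  \sum_w kneser_entry u w * (\sum_z kneser_entry w z * kneser_entry z v)
    + 2%:R * (\sum_w kneser_entry u w * kneser_entry w v)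
  = 5%:R * kneser_entry u v + 6%:R * (u == v)%:R + 2%:R.
Proof.
under eq_bigr do rewrite kneser_entry_square.
rewrite kneser_entry_square.
have -> : \sum_w kneser_entry u w * 'C(#|val w :&: val v|.+1, 3)%:R =
    (\sum_(w | adj u w) 'C(#|val w :&: val v|.+1, 3))%:R :> rat.
  rewrite natr_sum [RHS]big_mkcond; apply: eq_bigr => w _.
  by rewrite /kneser_entry; case: adj; rewrite ?mul1r ?mul0r.
rewrite card_walks3 /kneser_entry /kneser_adj -setI_eq0 -cards_eq0.
have -> : (u == v) = (#|val u :&: val v| == 3%N).
  apply/eqP/eqP => [-> | cI]; first by rewrite setIid card_vertex.
  apply: val_inj; have /setIidPl uv : val u \subset val v.
    by apply/setIidPl/eqP; rewrite eqEcard subsetIl cI card_vertex.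
  by apply/eqP; rewrite eqEcard -uv subsetIr uv !card_vertex.
have q3 := cardsID (val u) (val v); rewrite card_vertex setIC in q3.
have -> : ~: val u :&: val v = val v :\: val u by rewrite setDE setIC.
have -> : #|val v :\: val u| = (3 - #|val u :&: val v|)%N by lia.
have : (#|val u :&: val v| <= 3)%N by lia.
by case: #|val u :&: val v| => [|[|[|[|]]]].
Qed.

(** * Components after deleting a vertex set *)

Section Components.
Variables (V : finType) (adj : rel V) (S : {set V}).
Hypothesis adj_sym : symmetric adj.

Definition components : {set {set V}} := [set comp_minus adj S x | x in ~: S].

(** In a simple graph, twice the number of edges inside [C]. *)
Definition degree_sum (C : {set V}) : nat := \sum_(u in C) \sum_(v in C) adj u v.

Let conn_sym : connect_sym (adj_minus adj S).
Proof.
apply: sym_connect_sym => u v.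
by rewrite /adj_minus adj_sym; do 2 case: (_ \in S).
Qed.

Lemma components_partition : partition components (~: S).
Proof.
apply: (equivalence_partitionP (R := connect (adj_minus adj S))).
move=> x y z _ _ _; split; first exact: connect0.
by move=> xy; apply/idP/idP; apply: connect_trans => //; rewrite conn_sym.
Qed.

Lemma component_of C u : C \in components -> u \in C -> comp_minus adj S u = C.
Proof.
case/imsetP=> x _ ->; rewrite inE => /andP[_ xu]; apply/setP=> y; rewrite !inE.
case: (y \in S) => //=.
by apply/idP/idP; apply: connect_trans => //; rewrite conn_sym.
Qed.

Lemma mem_component u : u \notin S -> u \in comp_minus adj S u.
Proof. by move=> uS; rewrite !inE uS connect0. Qed.

Lemma component_subset C : C \in components -> C \subset ~: S.
Proof.
by case/imsetP=> x _ ->; apply/subsetP=> y; rewrite inE => /andP[].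
Qed.

Lemma component_adj C u v :
  C \in components -> u \in C -> v \notin S -> adj u v -> v \in C.
Proof.
move=> CP uC vS uv; rewrite -(component_of CP uC) !inE vS connect1 //.
rewrite /adj_minus vS uv.
by have := subsetP (component_subset CP) _ uC; rewrite inE => ->.
Qed.

Lemma component_sum (x : {set V} -> rat) (F : V -> rat) :
  \sum_u (if u \in ~: S then x (comp_minus adj S u) else 0) * F u =
  \sum_(C in components) x C * \sum_(u in C) F u.
Proof.
transitivity (\sum_(u in ~: S) x (comp_minus adj S u) * F u).
  rewrite [RHS]big_mkcond; apply: eq_bigr => u _.
  by case: (u \in ~: S); rewrite ?mul0r.
rewrite (set_partition_big _ components_partition).
apply: eq_bigr => C CP; rewrite mulr_sumr; apply: eq_bigr => u uC.
by rewrite (component_of CP uC).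
Qed.

(** No edge joins two different components and the vector vanishes on [S], so only edges inside a
    component contribute. *)
Lemma component_quadratic (x : {set V} -> rat) :
  let f u := if u \in ~: S then x (comp_minus adj S u) else 0 in
  \sum_u f u * (\sum_v (adj u v)%:R * f v) =
  \sum_(C in components) x C ^+ 2 * (degree_sum C)%:R.
Proof.
move=> f; rewrite component_sum; apply: eq_bigr => C CP.
rewrite expr2 -mulrA; congr (_ * _); rewrite /degree_sum natr_sum mulr_sumr.
apply: eq_bigr => u uC; rewrite natr_sum mulr_sumr [RHS]big_mkcond.
apply: eq_bigr => v _; rewrite /f; have [vC | vC] := ifPn (v \in C).
  have vS := subsetP (component_subset CP) _ vC.
  by rewrite vS (component_of CP vC) mulrC.
case: ifPn => [|_]; last by rewrite mulr0.
rewrite inE => vS; have [uv|] := boolP (adj u v); last by rewrite mul0r.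
by rewrite (component_adj CP uC vS uv) in vC.
Qed.

End Components.

(** No edge survives among the vertices of [A], so every path is empty and the components are
    singletons. *)
Lemma independent_components (V : finType) (adj : rel V) (A : {set V}) :
  independent adj A -> ncomp_minus adj (~: A) = #|A|.
Proof.
move=> indA; rewrite /ncomp_minus setCK -[RHS](card_imset _ set1_inj).
congr #|pred_of_set _|; apply: eq_in_imset => x xA.
apply/setP=> y; rewrite !inE negbK; apply/andP/eqP => [[yA /connectP[p]]|->].
  case: p => [|z p] //= /andP[] /and3P[_ zA xz] _ _.
  rewrite inE negbK in zA.
  by have /forall_inP/(_ z zA) := forall_inP indA x xA; rewrite xz.
by rewrite connect0.
Qed.

Lemma mantel (V : finType) (adj : rel V) (C : {set V}) :
  symmetric adj ->
  (forall u v w, adj u v -> adj u w -> ~~ adj v w) ->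
  (2 * degree_sum adj C <= #|C| ^ 2)%N.
Proof.
move=> adj_sym trifree.
have [C0 | C_gt0] := posnP #|C|.
  by rewrite (cards0_eq C0) /degree_sum big_set0.
pose d u : rat := \sum_(v in C) (adj u v)%:R; set m : rat := #|C|%:R.
have d_sum : \sum_(u in C) d u = (degree_sum adj C)%:R.
  by rewrite /degree_sum natr_sum; apply: eq_bigr => u _; rewrite natr_sum.
have m_gt0 : 0 < m by rewrite ltr0n.
(* Adjacent vertices have disjoint neighbourhoods in C, so d u + d v <= m. *)
have edge : 2%:R * \sum_(u in C) d u ^+ 2 <= m * (degree_sum adj C)%:R.
  have -> : 2%:R * \sum_(u in C) d u ^+ 2 =
      \sum_(u in C) \sum_(v in C) (adj u v)%:R * (d u + d v).
    transitivity (\sum_(u in C) \sum_(v in C) (adj u v)%:R * d u +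
                  \sum_(u in C) \sum_(v in C) (adj u v)%:R * d v).
      have -> : \sum_(u in C) \sum_(v in C) (adj u v)%:R * d v =
                \sum_(u in C) \sum_(v in C) (adj u v)%:R * d u.
        rewrite exchange_big; apply: eq_bigr => u _; apply: eq_bigr => v _.
        by rewrite adj_sym.
      rewrite mulr_sumr -big_split; apply: eq_bigr => u _.
      by rewrite -mulr_suml -/(d u) /=; ring.
    rewrite -big_split; apply: eq_bigr => u _; rewrite -big_split.
    by apply: eq_bigr => v _; rewrite mulrDr.
  rewrite -d_sum mulr_sumr; apply: ler_sum => u uC.
  rewrite mulr_sumr; apply: ler_sum => v vC; rewrite mulrC.
  have [uv | _] := boolP (adj u v); last by rewrite !mulr0.
  rewrite !mulr1 /d -big_split /m -sum1_card natr_sum; apply: ler_sum => w _.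
  have [uw | _] := boolP (adj u w); last by rewrite /= add0r ler_nat leq_b1.
  by rewrite (negbTE (trifree _ _ _ uv uw)) /= addr0.
(* With D the degree sum, this square gives 4mD <= 4 sum d^2 + m^3, and [edge] bounds 4 sum d^2 by
   2mD; dividing by m leaves 2D <= m^2. *)
have : 0 <= \sum_(u in C) (2%:R * d u - m) ^+ 2.
  by apply: sumr_ge0 => u _; apply: sqr_ge0.
have -> : \sum_(u in C) (2%:R * d u - m) ^+ 2 =
   4%:R * \sum_(u in C) d u ^+ 2 - 4%:R * m * (degree_sum adj C)%:R + m ^+ 3.
  have -> : m ^+ 3 = \sum_(u in C) m ^+ 2.
    by rewrite sumr_const -[RHS]mulr_natl exprS.
  rewrite -d_sum !mulr_sumr -sumrB -big_split /=.
  by apply: eq_bigr => u _; ring.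
move=> sq; rewrite -(ler_nat rat) natrM natrX -/m -(ler_pM2l m_gt0).
nra.
Qed.

(** * Edge bounds for vertex sets of K(7,3) *)

Lemma kneser_weighted (f : vertex -> rat) :
  (\sum_u f u) ^+ 2 <= 5%:R * \sum_u f u * (\sum_v (adj u v)%:R * f v)
                       + 15%:R * \sum_u f u * f u.
Proof.
by have [] := quadratic_forms kneser_entry_sym kneser_entry_regular card_kneser
  kneser_entry_cubic f.
Qed.

(** Both quadratic forms are evaluated at the indicator vector of [C]. *)
Lemma kneser_degree_sum (C : {set vertex}) :
  (#|C| ^ 2 <= 5 * degree_sum adj C + 15 * #|C|)%N /\
  (35 * degree_sum adj C <= 70 * #|C| + 2 * #|C| ^ 2)%N.
Proof.
pose f u : rat := (u \in C)%:R.
have fC F : \sum_u f u * F u = \sum_(u in C) F u.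
  rewrite [RHS]big_mkcond; apply: eq_bigr => u _; rewrite /f.
  by case: (u \in C); rewrite ?mul1r ?mul0r.
have s1 : \sum_u f u = #|C|%:R.
  by rewrite -sum1_card natr_sum -fC; apply: eq_bigr => u _; rewrite mulr1.
have s0 : dot f f = #|C|%:R.
  by rewrite -s1; apply: eq_bigr => u _; rewrite /f; case: (_ \in _); rewrite ?mulr1 ?mulr0.
have s2 : dot f (adj_op kneser_entry f) = (degree_sum adj C)%:R.
  rewrite /dot fC natr_sum; apply: eq_bigr => u _; rewrite natr_sum -fC.
  by apply: eq_bigr => v _; rewrite mulrC.
have [] := quadratic_forms kneser_entry_sym kneser_entry_regular card_kneser
  kneser_entry_cubic f.
rewrite s0 s1 s2 -!natrX -!natrM -!natrD !ler_nat.
by split.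
Qed.

Lemma kneser_triangle_free (u v w : vertex) : adj u v -> adj u w -> ~~ adj v w.
Proof.
move=> uv uw; apply/negP=> vw.
have := card_common_neighbors u w.
have -> : val u :&: val w = set0 by apply/eqP; rewrite setI_eq0.
rewrite cards0 => /cards0_eq/setP/(_ v).
by rewrite !inE uv vw.
Qed.

(** A finite check, sharp in its range: at m = 30 integrality gives k <= 111 and 94 * 201 = 18894 <
    18900, while at m = 31 the hypotheses allow k = 116, where the inequality fails. *)
Lemma component_gap (m k : nat) :
  (0 < m <= 30)%N -> (2 * k <= m ^ 2)%N -> (35 * k <= 70 * m + 2 * m ^ 2)%N ->
  ((3 * m + 4) * (3 * m + k) <= 21 * m ^ 2 ?= iff (m == 1))%N.
Proof.
move=> /andP[m_gt0 m_le] mantel_k spectral_k; apply/leqifP.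
have [m1 | m_neq1] := eqVneq m 1%N; first by apply/eqP; nia.
have {m_le} : (m < 31)%N by lia.
move: m_gt0 m_neq1 mantel_k spectral_k.
do 31 (case: m => [|m]; first by rewrite ?expnS ?expn0; lia).
by lia.
Qed.

(** * The inequality for a vertex cut *)

Section Cut.
Variable S : {set vertex}.
Hypothesis cutS : vertex_cut adj S.

Let P := components adj S.
Let partP : partition P (~: S) := components_partition S kneser_sym.

Lemma component_card C : C \in P -> (0 < #|C| <= 30)%N.
Proof.
move=> CP; have [_ _ P0] := and3P partP.
have C0 : C != set0 by apply: contraNneq P0 => <-.
rewrite card_gt0 C0 /=.
have : (0 < #|P :\ C|)%N.
  by move: cutS; rewrite -[vertex_cut _ _]/(1 < #|P|)%N (cardsD1 C P) CP.
rewrite card_gt0 => /set0Pn[D]; rewrite !inE => /andP[DC DP].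
have /set0Pn[y yD] : D != set0 by apply: contraNneq P0 => <-.
have yS := subsetP (component_subset DP) _ yD; rewrite inE in yS.
have yC : y \notin C.
  apply: contra DC => yC.
  by rewrite -(component_of kneser_sym DP yD) (component_of kneser_sym CP yC).
have sub : C \subset ~: (y |: [set w | adj y w]).
  apply/subsetP=> w wC; rewrite !inE negb_or; apply/andP; split.
    by apply: contraNneq yC => <-.
  apply: contra yC => yw; apply: (component_adj kneser_sym CP wC yS).
  by rewrite kneser_sym.
apply: leq_trans (subset_leq_card sub) _.
by rewrite cardsCs setCK cardsU1 card_neighbors inE kneser_irr card_kneser.
Qed.

Let m (C : {set vertex}) : rat := #|C|%:R.
Let b (C : {set vertex}) : rat := (3 * #|C| + degree_sum adj C)%:R.

Lemma sum_component_le5 : \sum_(C in P) m C ^+ 2 / b C <= 5%:R.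
Proof.
have b_gt0 C : C \in P -> 0 < b C.
  by move=> /component_card/andP[C0 _]; rewrite ltr0n addn_gt0 muln_gt0 C0.
set H := \sum_(C in P) _.
have H_ge0 : 0 <= H.
  by apply: sumr_ge0 => C /b_gt0 bC; rewrite divr_ge0 ?sqr_ge0 // ltW.
(* By Cauchy-Schwarz this weight maximises (sum m x)^2 / sum b x^2, the ratio that [kneser_weighted]
   bounds by 5. *)
pose x C := m C / b C.
pose f u := if u \in ~: S then x (comp_minus adj S u) else 0.
have := kneser_weighted f.
have -> : \sum_u f u = H.
  transitivity (\sum_u f u * 1); first by apply: eq_bigr => u _; rewrite mulr1.
  rewrite (component_sum S kneser_sym); apply: eq_bigr => C _.
  by rewrite sumr_const -/(m C) /x mulrAC expr2.
rewrite (component_quadratic S kneser_sym).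
have -> : \sum_u f u * f u = \sum_(C in P) x C ^+ 2 * m C.
  transitivity (\sum_u (if u \in ~: S then (fun C => x C ^+ 2) (comp_minus adj S u) else 0) * 1).
    by apply: eq_bigr => u _; rewrite /f; case: ifP => _; rewrite /= ?mulr1 ?mulr0 ?expr2.
  rewrite (component_sum S kneser_sym (fun C => x C ^+ 2)); apply: eq_bigr => C _.
  by rewrite sumr_const.
have -> : 5%:R * \sum_(C in components adj S) x C ^+ 2 * (degree_sum adj C)%:R +
    15%:R * \sum_(C in P) x C ^+ 2 * m C = 5%:R * H.
  rewrite !mulr_sumr -big_split /=; apply: eq_bigr => C CP.
  have bE : b C = 3%:R * m C + (degree_sum adj C)%:R by rewrite /b natrD natrM.
  have -> : m C ^+ 2 / b C = x C ^+ 2 * b C.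
    have : b C != 0 by rewrite gt_eqF ?b_gt0.
    by rewrite /x; move: (m C) (b C) => y z z0; field.
  by rewrite bE; ring.
(* What remains is H^2 <= 5H, to be divided by H. *)
have [->|H_neq0] := eqVneq H 0; first by [].
by rewrite expr2 ler_pM2r // lt_def H_neq0.
Qed.

Lemma cut_bound :
  (4 * ncomp_minus adj S <= 3 * #|S|)%N /\
  (4 * ncomp_minus adj S = 3 * #|S| -> forall C, C \in P -> #|C| = 1)%N.
Proof.
have gap C : C \in P ->
    m C + 4%:R / 3%:R <= 7%:R * (m C ^+ 2 / b C) ?= iff (#|C| == 1%N).
  move=> CP; have [_ spectral] := kneser_degree_sum C.
  have b_gt0 : 0 < b C.
    by have /andP[C0 _] := component_card CP; rewrite ltr0n addn_gt0 muln_gt0 C0.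
  have b3_gt0 : 0 < 3%:R * b C by rewrite mulr_gt0.
  (* Multiplying by 3b clears the denominators and leaves the integer inequality of
     [component_gap]. *)
  rewrite -(mono_leif (ler_pM2r b3_gt0)).
  have -> : (m C + 4%:R / 3%:R) * (3%:R * b C) =
      ((3 * #|C| + 4) * (3 * #|C| + degree_sum adj C))%N%:R.
    by rewrite natrM -/(b C) natrD natrM -/(m C); field.
  have -> : 7%:R * (m C ^+ 2 / b C) * (3%:R * b C) = (21 * #|C| ^ 2)%N%:R.
    rewrite natrM natrX -/(m C); have : b C != 0 by rewrite gt_eqF.
    by move: (m C) (b C) => y z z0; field.
  rewrite leif_nat_r; apply: component_gap => //; first exact: component_card.
  exact: mantel kneser_sym kneser_triangle_free.
have [gap_le gap_eq] := leif_sum gap.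
have sum_m : \sum_(C in P) m C = (35 - #|S|)%N%:R.
  rewrite -natr_sum -(card_partition partP); congr _%:R.
  by rewrite cardsCs setCK card_kneser.
have S35 : (#|S| <= 35)%N by rewrite -card_kneser max_card.
have lhs : \sum_(C in P) (m C + 4%:R / 3%:R) =
    35%:R - #|S|%:R + 4%:R / 3%:R * #|P|%:R.
  by rewrite big_split /= sum_m natrB // sumr_const -[X in _ + X = _]mulr_natr.
have rhs : \sum_(C in P) 7%:R * (m C ^+ 2 / b C) <= 35%:R.
  by rewrite -mulr_sumr; have := sum_component_le5; lra.
rewrite lhs in gap_le gap_eq.
split=> [|tight].
  rewrite -(ler_nat rat) !natrM -/P; lra.
move/(congr1 (fun n => n%:R : rat)): tight; rewrite !natrM => tight.
suff /forall_inP singles : [forall (C | C \in P), #|C| == 1%N].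
  by move=> C /singles/eqP.
(* Under [tight] the left sum equals 35, which bounds the right sum; the two sums therefore agree,
   and every summand is in its equality case. *)
rewrite -gap_eq eq_le gap_le /=.
move: tight; rewrite /ncomp_minus -/(components adj S) -/P; lra.
Qed.
End Cut.

(** * Maximum independent sets and the extremal cuts *)

Lemma kneser_independent_card (B : {set vertex}) :
  independent adj B -> (#|B| <= 15)%N.
Proof.
move=> indB; have [] := kneser_degree_sum B.
have -> : degree_sum adj B = 0%N.
  rewrite /degree_sum big1 // => u uB; rewrite big1 // => v vB.
  by have /forall_inP/(_ v vB)/negbTE-> := forall_inP indB u uB.
(* With no inner edge the first bound is m^2 <= 15m, which is Hoffman's ratio bound 35 * 3 / (4 +
   3). *)
nia.
Qed.

Lemma max_independent15 (A : {set vertex}) :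
  independent adj A -> #|A| = 15%N -> max_independent adj A.
Proof.
move=> indA cA; rewrite /max_independent indA cA /=.
by apply/forallP=> B; apply/implyP; apply: kneser_independent_card.
Qed.

Definition star : {set vertex} := [set u : vertex | ord0 \in val u].

Lemma star_independent : independent adj star.
Proof.
apply/forall_inP=> u; rewrite inE => u0; apply/forall_inP=> v; rewrite inE => v0.
by apply/negP=> /disjointFr/(_ u0); rewrite v0.
Qed.

Lemma card_star_setC : #|~: star| = 20%N.
Proof.
transitivity 'C(#|[set~ ord0] : {set 'I_7}|, 3); last by rewrite cardsC1 card_ord.
rewrite -card_neighbors_setC; apply: eq_card => u; rewrite !inE.
by rewrite subsetC sub1set inE.
Qed.

Lemma card_star : #|star| = 15%N.
Proof. by rewrite cardsCs card_star_setC card_kneser. Qed.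

Lemma cut_ratio_ge S : vertex_cut adj S -> 4%:R / 3%:R <= cut_ratio adj S.
Proof.
move=> cutS; have [bound _] := cut_bound cutS.
have c_gt0 : (0 : rat) < (ncomp_minus adj S)%:R by rewrite ltr0n ltnW.
rewrite /cut_ratio ler_pdivlMr //; move: bound; rewrite -(ler_nat rat) !natrM; lra.
Qed.

Theorem theorem4p3 :
  toughness (kneser_adj 7 3) = (4%:R / 3%:R)%R /\
  (forall S : {set kneser_vertex 7 3},
     vertex_cut (kneser_adj 7 3) S ->
     cut_ratio (kneser_adj 7 3) S = (4%:R / 3%:R)%R ->
     exists A : {set kneser_vertex 7 3},
       max_independent (kneser_adj 7 3) A /\ S = ~: A).
Proof.
have nstar : ncomp_minus adj (~: star) = 15%N.
  by rewrite (independent_components star_independent) card_star.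
split.
  apply: le_anti; apply/andP; split.
    have -> : 4%:R / 3%:R = cut_ratio adj (~: star).
      by rewrite /cut_ratio nstar card_star_setC.
    by apply: bigmin_le_cond; rewrite /vertex_cut nstar.
  (* The default value of the minimum, 35, must also be at least 4/3. *)
  by apply: le_bigmin => [|S /cut_ratio_ge]; first by rewrite card_kneser.
move=> S cutS ratioS; have [_ tight] := cut_bound cutS.
have c_gt0 : (0 : rat) < (ncomp_minus adj S)%:R by rewrite ltr0n ltnW.
have tightS : (4 * ncomp_minus adj S = 3 * #|S|)%N.
  apply/eqP; rewrite -(eqr_nat rat) !natrM; apply/eqP.
  have : #|S|%:R = 4%:R / 3%:R * (ncomp_minus adj S)%:R :> rat.
    by rewrite -ratioS /cut_ratio divfK ?gt_eqF.
  lra.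
have singles := tight tightS.
have cW : #|~: S| = ncomp_minus adj S.
  by rewrite (card_uniform_partition singles (components_partition S kneser_sym)) muln1.
exists (~: S); split; last by rewrite setCK.
(* As the components are single vertices, c = 35 - |S|; then 4c = 3|S| forces |S| = 20 and leaves 15
   vertices. *)
apply: max_independent15; last first.
  have cS : #|~: S| = (35 - #|S|)%N by rewrite cardsCs setCK card_kneser.
  by move: tightS; rewrite -cW cS; move: #|S| => s; lia.
apply/forall_inP=> u; rewrite inE => uS; apply/forall_inP=> v; rewrite inE => vS.
(* Adjacent vertices outside [S] would share a component, which is a singleton, and so would form a
   loop. *)
apply/negP=> uv; have uC := mem_component adj uS.
have CP : comp_minus adj S u \in components adj S by apply: imset_f; rewrite inE.
have vC := component_adj kneser_sym CP uC vS uv.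
have /eqP/cards1P[w Cw] := singles _ CP.
by move: uC vC uv; rewrite Cw !inE => /eqP-> /eqP->; rewrite kneser_irr.
Qed.
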